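(* Let $T\in M^{m\times n}(\mathbb{C})$ and let $T=U-V$ be a proper splitting of $T$. Then the following assertions are equivalent: (a) $0\leq U^\dagger T\leq P_{T^*}$; (b) $U^\dagger V\in M^n_+(\mathbb{C})$ and $\rho(U^\dagger V)=\dfrac{\rho(T^\dagger U)-1}{\rho(T^\dagger U)}<1$.
   Context: $M^{m\times n}(\mathbb{C})$ denotes the complex $m\times n$ matrices; $M^n_+(\mathbb{C})$ is the set of positive semidefinite $n\times n$ complex matrices (i.e. $\langle Ax,x\rangle\ge0$ for all $x\in\mathbb{C}^n$); $\leq$ is the Löwner order: for Hermitian $A,B$, $A\le B$ iff $B-A\in M^n_+(\mathbb{C})$. $A^\dagger$ is the Moore-Penrose inverse, $\mathcal{R}(\cdot)$, $\mathcal{N}(\cdot)$, $\rho(\cdot)$ denote range, nullspace and spectral radius, and $P_{T^*}$ is the orthogonal projection onto $\mathcal{R}(T^* )$. Proper splitting: a decomposition $T=U-V$ with $U,V\in M^{m\times n}(\mathbb{C})$ is a proper splitting of $T\in M^{m\times n}(\mathbb{C})$ if $\mathcal{R}(U)=\mathcal{R}(T)$ and $\mathcal{N}(U)=\mathcal{N}(T)$. *)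

(* Defs.v *)
From mathcomp Require Import all_boot all_order all_algebra.
From mathcomp Require Import classical_sets reals.
From mathcomp Require Import complex.

Set Implicit Arguments.
Unset Strict Implicit.
Unset Printing Implicit Defensive.

Import Order.TTheory GRing.Theory Num.Theory.

Local Open Scope classical_set_scope.
Local Open Scope ring_scope.
Local Open Scope sesquilinear_scope.
Local Open Scope complex_scope.

(* Matrices act on column vectors; this differs from the row-space conventions
   of mxalgebra, whence the set-based range and nullspace. *)
Definition mxrange (R : realType) (m n : nat) (A : 'M[R[i]]_(m, n)) :
    set 'cV[R[i]]_m :=
  range (fun x : 'cV[R[i]]_n => A *m x).

Definition mxnull (R : realType) (m n : nat) (A : 'M[R[i]]_(m, n)) :
    set 'cV[R[i]]_n :=
  [set x | A *m x = 0].

Definition proper_splitting (R : realType) (m n : nat)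
    (T U V : 'M[R[i]]_(m, n)) : Prop :=
  [/\ T = U - V, mxrange U = mxrange T & mxnull U = mxnull T].

(* The order of R[i] is partial: 0 <= z means that z is real and nonnegative. *)
Definition psdmx (R : realType) (n : nat) (A : 'M[R[i]]_n) : Prop :=
  forall x : 'cV[R[i]]_n, 0 <= (x^t* *m (A *m x)) 0 0.

Definition loewner_le (R : realType) (n : nat) (A B : 'M[R[i]]_n) : Prop :=
  [/\ A \is hermsymmx, B \is hermsymmx & psdmx (B - A)].

Definition is_mpinv (R : realType) (m n : nat)
    (A : 'M[R[i]]_(m, n)) (X : 'M[R[i]]_(n, m)) : Prop :=
  [/\ A *m X *m A = A,
      X *m A *m X = X,
      (A *m X)^t* = A *m X
    & (X *m A)^t* = X *m A].

(* The default value 0 is never used: see mpinvP. *)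
Definition mpinv (R : realType) (m n : nat) (A : 'M[R[i]]_(m, n)) :
    'M[R[i]]_(n, m) :=
  xget 0 [set X | is_mpinv A X].

Definition is_orthoproj (R : realType) (n : nat)
    (S : set 'cV[R[i]]_n) (P : 'M[R[i]]_n) : Prop :=
  [/\ P *m P = P, P^t* = P & mxrange P = S].

(* Meaningful when S is a linear subspace; see orthoprojP for S a range. *)
Definition orthoproj (R : realType) (n : nat) (S : set 'cV[R[i]]_n) :
    'M[R[i]]_n :=
  xget 0 [set P | is_orthoproj S P].

(* eigenvalue refers to row eigenvectors, but A and A^T have the same spectrum.
   For n = 0 the spectrum is empty and the value is 0. *)
Definition spectral_radius (R : realType) (n : nat) (A : 'M[R[i]]_n) : R :=
  sup [set Normc.normc a | a in [set a : R[i] | eigenvalue A a]].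

Lemma adjmxM (R : realType) (m n p : nat)
    (A : 'M[R[i]]_(m, n)) (B : 'M[R[i]]_(n, p)) :
  (A *m B)^t* = B^t* *m A^t*.
Proof. by rewrite trmx_mul map_mxM. Qed.

Lemma mulmx_adj_eq0 (R : realType) (m n : nat) (A : 'M[R[i]]_(m, n)) :
  A *m A^t* = 0 -> A = 0.
Proof.
move=> AA0; apply/row_matrixP => i; rewrite row0; apply/eqP.
rewrite -(dnorm_eq0 (@dotmx _ n)) /= dotmxE.
have -> : (row i A *m (row i A)^t*) 0 0 = (A *m A^t*) i i.
  by rewrite !mxE; apply: eq_bigr => j _; rewrite !mxE.
by rewrite AA0 mxE.
Qed.

Lemma gram_unit (R : realType) (r n : nat) (G : 'M[R[i]]_(r, n)) :
  row_free G -> G *m G^t* \in unitmx.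
Proof.
move=> Gfree; rewrite -row_free_unit -kermx_eq0; apply/eqP.
set K := kermx _; have K0 : K *m (G *m G^t*) = 0 by apply: mulmx_ker.
have: (K *m G) = 0.
  by apply: mulmx_adj_eq0; rewrite adjmxM mulmxA -(mulmxA K) K0 mul0mx.
by move=> KG0; apply: (row_free_inj Gfree); rewrite KG0 mul0mx.
Qed.

Lemma adj_inv (R : realType) (n : nat) (A : 'M[R[i]]_n) :
  A^t* = A -> (invmx A)^t* = invmx A.
Proof. by move=> A_sym; rewrite trmx_inv map_invmx A_sym. Qed.

Lemma mpinv_exists (R : realType) (m n : nat) (A : 'M[R[i]]_(m, n)) :
  exists X, is_mpinv A X.
Proof.
have [r [F [G [Ffull Gfree AE]]]] : exists r (F : 'M[R[i]]_(m, r))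
    (G : 'M[R[i]]_(r, n)), [/\ row_full F, row_free G & A = F *m G].
  exists (\rank A), (col_base A), (row_base A).
  by rewrite col_base_full row_base_free mulmx_base.
pose g := G *m G^t*; pose f := F^t* *m F.
have gu : g \in unitmx by apply: gram_unit.
have fu : f \in unitmx.
  rewrite /f -{2}[F]trmxCK; apply: gram_unit.
  by rewrite /row_free mxrank_map mxrank_tr -/(row_full F).
have gs : g^t* = g by rewrite adjmxM trmxCK.
have fs : f^t* = f by rewrite adjmxM trmxCK.
pose X := G^t* *m invmx g *m (invmx f *m F^t*).
have AX : A *m X = F *m (invmx f *m F^t*).
  by rewrite AE /X -!mulmxA (mulmxA G) -/g (mulmxA g) mulmxV // mul1mx.
have XA : X *m A = G^t* *m invmx g *m G.
  by rewrite AE /X -!mulmxA (mulmxA (F^t*)) -/f (mulmxA (invmx f)) mulVmx // mul1mx.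
exists X; split.
- by rewrite AX AE -!mulmxA (mulmxA (F^t*)) -/f (mulmxA (invmx f)) mulVmx // mul1mx.
- by rewrite XA /X -!mulmxA (mulmxA G) -/g (mulmxA g) mulmxV // mul1mx.
- by rewrite AX !adjmxM adj_inv // trmxCK mulmxA.
- by rewrite XA !adjmxM adj_inv // trmxCK mulmxA.
Qed.

Lemma mpinvP (R : realType) (m n : nat) (A : 'M[R[i]]_(m, n)) :
  is_mpinv A (mpinv A).
Proof. exact: (xgetPex 0 (mpinv_exists A)). Qed.

Lemma is_mpinv_uniq (R : realType) (m n : nat) (A : 'M[R[i]]_(m, n))
    (X Y : 'M[R[i]]_(n, m)) :
  is_mpinv A X -> is_mpinv A Y -> X = Y.
Proof.
case=> [AXA XAX AXs XAs] [AYA YAY AYs YAs].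
have AXY : A *m X = A *m Y.
  by rewrite -{1}AYA -mulmxA -[in LHS]AYs -[in LHS]AXs -adjmxM mulmxA AXA.
have XYA : X *m A = Y *m A.
  rewrite -{1}AYA -(mulmxA A) mulmxA -[in LHS]YAs -[in LHS]XAs -adjmxM.
  by rewrite -mulmxA (mulmxA A) AXA.
by rewrite -XAX -mulmxA AXY mulmxA XYA YAY.
Qed.

Lemma is_orthoproj_uniq (R : realType) (n : nat) (S : set 'cV[R[i]]_n)
    (P Q : 'M[R[i]]_n) :
  is_orthoproj S P -> is_orthoproj S Q -> P = Q.
Proof.
have absorb (P1 P2 : 'M[R[i]]_n) :
    is_orthoproj S P1 -> is_orthoproj S P2 -> P1 *m P2 = P2.
  case=> [P1P1 _ P1S] [_ _ P2S]; apply/matrixP => i j.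
  have /= [x _ xE] : mxrange P1 (col j P2).
    by rewrite P1S -P2S; exists (delta_mx j 0); rewrite // colE.
  have : col j (P1 *m P2) = col j P2.
    by rewrite colE -mulmxA -colE -xE mulmxA P1P1.
  by move/colP/(_ i); rewrite [LHS]mxE [RHS]mxE.
move=> hP hQ; case: (hP) (hQ) => _ Ps _ [_ Qs _].
by rewrite -Ps -(absorb _ _ hQ hP) adjmxM Ps Qs absorb.
Qed.

Lemma orthoprojP (R : realType) (m n : nat) (A : 'M[R[i]]_(m, n)) :
  is_orthoproj (mxrange A) (orthoproj (mxrange A)).
Proof.
apply: (@xgetPex _ 0 [set P | is_orthoproj (mxrange A) P]).
have [AXA XAX AXs _] := mpinvP A.
exists (A *m mpinv A); split=> //; first by rewrite mulmxA AXA.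
apply/seteqP; split=> _ /= [x _ <-]; first by exists (mpinv A *m x); rewrite ?mulmxA.
by exists (A *m x); rewrite // mulmxA AXA.
Qed.

(* Main.v *)
(* With P = U^dagger U = T^dagger T the orthogonal projection onto R(T^* ),
   the matrices A = U^dagger T and X = T^dagger U are inverse to each other on
   the range of P, and U^dagger V = P - A. Hence the nonzero eigenvalues of
   P - A are the numbers 1 - 1/x different from 0 with x a nonzero eigenvalue
   of X, and this map preserves the largest eigenvalue when A and P - A are
   positive semidefinite. Conversely a positive semidefinite B = BP with
   spectral radius below 1 satisfies B <= P. *)
Require Import Defs.
From mathcomp Require Import all_boot all_order all_algebra.
From mathcomp Require Import boolp classical_sets reals.
From mathcomp Require Import complex.

Set Implicit Arguments.
Unset Strict Implicit.
Unset Printing Implicit Defensive.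

Import Order.TTheory GRing.Theory Num.Theory.

Local Open Scope ring_scope.
Local Open Scope sesquilinear_scope.
Local Open Scope complex_scope.

(** * Normal and Hermitian matrices: unitary diagonalization and quadratic forms *)

Lemma hermsymmxP (R : realType) (n : nat) (A : 'M[R[i]]_n) :
  reflect (A^t* = A) (A \is hermsymmx).
Proof. by apply: (iffP (is_hermitianmxP _ _ _)); rewrite expr0 scale1r => /esym. Qed.

Lemma spectralmx_mul (C : numClosedFieldType) (n : nat) (A : 'M[C]_n) :
  A \is normalmx ->
  spectralmx A *m A = diag_mx (spectral_diag A) *m spectralmx A.
Proof.
move=> /orthomx_spectralP AE.
by rewrite {2}AE -!mulmxA mulKVmx ?spectral_unit.
Qed.

(** The rows of the diagonalizing unitary matrix are row eigenvectors, nonzero because that matrix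
    is invertible. *)
Lemma spectral_diag_eigenvalue (C : numClosedFieldType) (n : nat)
    (A : 'M[C]_n) (k : 'I_n) :
  A \is normalmx -> eigenvalue A (spectral_diag A 0 k).
Proof.
move=> A_normal; apply/eigenvalueP; exists (row k (spectralmx A)).
  by rewrite -row_mul spectralmx_mul // row_mul row_diag_mx -scalemxAl -rowE.
apply/eqP => row0; have Qfree : row_free (spectralmx A).
  by rewrite row_free_unit spectral_unit.
have: delta_mx 0 k *m spectralmx A = 0 *m spectralmx A :> 'rV_n.
  by rewrite -rowE row0 mul0mx.
move/(row_free_inj Qfree)/rowP/(_ k)/eqP.
by rewrite !mxE !eqxx oner_eq0.
Qed.

Lemma normalmx_quadratic (C : numClosedFieldType) (n : nat) (A : 'M[C]_n)
    (x : 'cV[C]_n) :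
  A \is normalmx ->
  (x^t* *m (A *m x)) 0 0 =
    \sum_k spectral_diag A 0 k * `|(spectralmx A *m x) k 0| ^+ 2.
Proof.
move=> /orthomx_spectralP AE; rewrite {1}AE; set Q := spectralmx A.
rewrite invmx_unitary ?spectral_unitarymx // !mulmxA.
have -> : x^t* *m Q^t* = (Q *m x)^t* by rewrite trmx_mul map_mxM.
rewrite -mulmxA mxE; apply: eq_bigr => k _.
by rewrite mul_mx_diag !mxE normCK [LHS]mulrAC [LHS]mulrC [X in _ * X = _]mulrC.
Qed.

Lemma normalmx_neq0 (C : numClosedFieldType) (n : nat) (A : 'M[C]_n) :
  A \is normalmx -> A != 0 -> exists2 a, eigenvalue A a & a != 0.
Proof.
move=> A_normal A0; have: spectral_diag A != 0.
  apply: contra_neq A0 => d0.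
  by rewrite (orthomx_spectralP A_normal) d0 linear0 mulmx0 mul0mx.
move=> /rV0Pn[k dk0]; exists (spectral_diag A 0 k) => //.
exact: spectral_diag_eigenvalue.
Qed.

Lemma quadratic_sub (C : numClosedFieldType) (n : nat) (A B : 'M[C]_n)
    (x : 'cV[C]_n) :
  (x^t* *m ((A - B) *m x)) 0 0 =
    (x^t* *m (A *m x)) 0 0 - (x^t* *m (B *m x)) 0 0.
Proof. by rewrite mulmxBl mulmxBr [LHS]mxE [X in _ + X]mxE. Qed.

(** For a row eigenvector [v], take [x = v^t*] and [c] the squared norm of [v]; sign information on
    the form thus passes to the eigenvalues. *)
Lemma eigenvalue_quadratic (C : numClosedFieldType) (n : nat) (A : 'M[C]_n)
    (a : C) :
  eigenvalue A a ->
  exists x : 'cV[C]_n, exists2 c : C, 0 < c & (x^t* *m (A *m x)) 0 0 = a * c.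
Proof.
move=> /eigenvalueP[v vA v0]; exists (v^t*), ((v *m v^t*) 0 0).
  by have := @dnorm_gt0 _ _ (@dotmx C n) v; rewrite /= dotmxE v0.
by rewrite trmxCK mulmxA vA -scalemxAl mxE.
Qed.

Lemma psdmx_eigenvalue (R : realType) (n : nat) (A : 'M[R[i]]_n) (a : R[i]) :
  psdmx A -> eigenvalue A a -> 0 <= a.
Proof.
move=> A_psd /eigenvalue_quadratic[x [c c0 xE]].
by have := A_psd x; rewrite xE pmulr_lge0.
Qed.

Lemma quadratic_adj (C : numClosedFieldType) (n : nat) (A : 'M[C]_n)
    (x : 'cV[C]_n) :
  (x^t* *m (A^t* *m x)) 0 0 = (((x^t* *m (A *m x)) 0 0)^*)%R.
Proof.
have -> : x^t* *m (A^t* *m x) = (x^t* *m (A *m x))^t*.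
  by rewrite !trmx_mul !map_mxM trmxCK mulmxA.
by rewrite !mxE.
Qed.

(* The skew-Hermitian matrix [A - A^t*] is normal and its quadratic form
   vanishes, hence so do its eigenvalues. *)
Lemma psdmx_herm (R : realType) (n : nat) (A : 'M[R[i]]_n) :
  psdmx A -> A \is hermsymmx.
Proof.
move=> A_psd; apply/hermsymmxP/esym/eqP; rewrite -subr_eq0; apply/eqP.
have skew : (A - A^t*)^t* = - (A - A^t*).
  by rewrite linearB /= map_mxB trmxCK opprB.
have skew_normal : A - A^t* \is normalmx.
  by apply/normalmxP; rewrite skew mulmxN mulNmx.
apply: contraTeq isT => /(normalmx_neq0 skew_normal)[a].
move=> /eigenvalue_quadratic[x [c c0]].
rewrite quadratic_sub quadratic_adj (CrealP (ger0_real (A_psd x))) subrr.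
by move/esym/eqP; rewrite mulf_eq0 (gt_eqF c0) orbF => ->.
Qed.

(** In a unitary eigenbasis of [A] both forms are sums over the same squared coordinates, compared
    term by term. *)
Lemma psdmx_1sub (R : realType) (n : nat) (A : 'M[R[i]]_n) :
  A \is hermsymmx -> (forall a, eigenvalue A a -> a <= 1) -> psdmx (1%:M - A).
Proof.
move=> A_herm A_le1 x; have A_normal := hermitian_normalmx A_herm.
rewrite quadratic_sub mul1mx subr_ge0 normalmx_quadratic //.
have -> : (x^t* *m x) 0 0 = \sum_k `|(spectralmx A *m x) k 0| ^+ 2.
  rewrite -[X in _ *m X](mulKmx (spectral_unit A)).
  rewrite invmx_unitary ?spectral_unitarymx // !mulmxA -mulmxA.
  have -> : x^t* *m (spectralmx A)^t* = (spectralmx A *m x)^t*.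
    by rewrite trmx_mul map_mxM.
  by rewrite mxE; apply: eq_bigr => k _; rewrite normCK mulrC !mxE.
apply: ler_sum => k _; rewrite ler_piMl ?exprn_ge0 //.
exact/A_le1/spectral_diag_eigenvalue.
Qed.

(** * Spectral radius as a maximum over the finite spectrum *)

Lemma eigenvalue_seq (C : closedFieldType) (n : nat) (A : 'M[C]_n) :
  exists r : seq C, forall a, eigenvalue A a = (a \in r).
Proof.
have [r pE] := closed_field_poly_normal (char_poly A).
exists r => a; rewrite eigenvalue_root_char pE.
by rewrite (monicP (char_poly_monic A)) scale1r root_prod_XsubC.
Qed.

(** The eigenvalue [a] makes the spectrum nonempty; being finite, it attains the supremum of its
    moduli. *)
Lemma spectral_radius_max (R : realType) (n : nat) (A : 'M[R[i]]_n)
    (a : R[i]) :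
  eigenvalue A a ->
  exists b, [/\ eigenvalue A b, (spectral_radius A)%:C = `|b| &
                forall c, eigenvalue A c -> `|c| <= `|b|].
Proof.
have [r rE] := eigenvalue_seq A; rewrite rE => /(nthP 0)[k0 lt_k0 _].
have [k _ k_max] := @arg_maxP _ _ _ (Ordinal lt_k0) xpredT
  (fun k : 'I_(size r) => Normc.normc r`_k) isT.
have max_k c : eigenvalue A c -> Normc.normc c <= Normc.normc r`_k.
  by rewrite rE => /(nthP 0)[j lt_j <-]; apply: (k_max (Ordinal lt_j)).
have Ark : eigenvalue A r`_k by rewrite rE mem_nth.
exists r`_k; split=> // [|c /max_k]; last by rewrite -lecR.
suff -> : spectral_radius A = Normc.normc r`_k by [].
have ubk : ubound [set Normc.normc c | c in [set c | eigenvalue A c]]%classic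
    (Normc.normc r`_k) by move=> _ [c /max_k le_c <-].
apply/le_anti/andP; split.
  by apply: ge_sup => //; exists (Normc.normc r`_k), r`_k.
by apply: ub_le_sup; [exists (Normc.normc r`_k) | exists r`_k].
Qed.

Lemma spectral_radius0 (R : realType) (n : nat) :
  spectral_radius (0 : 'M[R[i]]_n) = 0.
Proof.
have eig0 (a : R[i]) : eigenvalue (0 : 'M_n) a -> a = 0.
  move=> /eigenvalueP[v /esym/eqP]; rewrite mulmx0 scaler_eq0.
  by case: eqP => //= _ ->.
have [[a /spectral_radius_max[b [/eig0-> + _]]]|no_eig] :=
    pselect (exists a : R[i], eigenvalue (0 : 'M_n) a).
  by rewrite normr0 => /complexI.
(* Empty spectrum ([n = 0]): the supremum of the empty set is 0 by convention. *)
rewrite /spectral_radius [X in [set _ | _ in X]%classic](_ : _ = set0).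
  by rewrite image_set0 sup0.
by apply/seteqP; split=> // a /= a_eig; case: no_eig; exists a.
Qed.

(** * Spectra of [P - A] and of the inverse of [A] on the range of [P] *)

(* Nonzero eigenvalues of [B = P - A] and of [X], the inverse of [A] on the
   range of [P], correspond through [b = 1 - a^-1]. *)
Lemma eigenvalue_proj_sub (F : fieldType) (n : nat) (P A X : 'M[F]_n) (a : F) :
  A *m P = A -> X *m P = X -> X *m A = P ->
  eigenvalue X a -> a != 0 -> eigenvalue A a^-1 /\ eigenvalue (P - A) (1 - a^-1).
Proof.
move=> AP XP XA /eigenvalueP[v vX v0] a0.
have vP : v *m P = v.
  by apply: (scalerI a0); rewrite scalemxAl -vX -mulmxA XP.
have vA : v *m A = a^-1 *: v.
  by apply: (scalerI a0); rewrite scalerA divff // scale1r scalemxAl -vX -mulmxA XA.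
by split; apply/eigenvalueP; exists v; rewrite // mulmxBr vP vA scalerBl scale1r.
Qed.

Lemma eigenvalue_sub_proj (F : fieldType) (n : nat) (P A X : 'M[F]_n) (b : F) :
  P *m P = P -> A *m P = A -> A *m X = P ->
  eigenvalue (P - A) b -> b != 0 -> 1 - b != 0 /\ eigenvalue X (1 - b)^-1.
Proof.
move=> PP AP AX /eigenvalueP[v vB v0] b0.
have vP : v *m P = v.
  by apply: (scalerI b0); rewrite scalemxAl -vB -mulmxA mulmxBl PP AP.
have vA : v *m A = (1 - b) *: v.
  by rewrite scalerBl scale1r -vB mulmxBr vP subKr.
have vX : v = (1 - b) *: (v *m X) by rewrite scalemxAl -vA -mulmxA AX vP.
have b1 : 1 - b != 0 by apply: contra_neq v0 => b1; rewrite vX b1 scale0r.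
split=> //; apply/eigenvalueP; exists v => //.
by rewrite {2}vX scalerA mulVf ?scale1r.
Qed.

(** Adjoints give [X^t* *m A = P], so [X^t* = X^t* *m P = X^t* *m A *m X = P *m X = X]. Being
    normal, a nonzero [X] then has a nonzero eigenvalue. *)
Lemma herm_proj_inverse (R : realType) (n : nat) (P A X : 'M[R[i]]_n) :
  P^t* = P -> A^t* = A -> P *m X = X -> X *m P = X -> A *m X = P ->
  X^t* = X.
Proof.
move=> Ps As PX XP AX.
have XsP : X^t* *m P = X^t* by rewrite -{1}Ps -adjmxM PX.
have XsA : X^t* *m A = P by rewrite -{1}As -adjmxM AX.
by rewrite -XsP -AX mulmxA XsA PX.
Qed.

Lemma spectral_radius_proj_sub (R : realType) (n : nat) (P A X : 'M[R[i]]_n) :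
  P^t* = P -> P *m P = P -> A *m P = A -> P *m X = X -> X *m P = X ->
  A *m X = P -> X *m A = P -> psdmx A -> psdmx (P - A) ->
  spectral_radius (P - A) = (spectral_radius X - 1) / spectral_radius X /\
  spectral_radius (P - A) < 1.
Proof.
move=> Ps PP AP PX XP AX XA A_psd B_psd.
have As : A^t* = A by apply/hermsymmxP/psdmx_herm.
have Xs := herm_proj_inverse Ps As PX XP AX.
have [X0|X_neq0] := eqVneq X 0.
  (* Here [P] and [A] vanish as well, both radii are 0, and the convention [0^-1 = 0] makes the
     quotient 0. *)
  have P0 : P = 0 by rewrite -AX X0 mulmx0.
  rewrite P0 -AP P0 mulmx0 X0 subrr spectral_radius0 invr0 mulr0.
  by split; rewrite // ltr01.
have [mu X_mu mu0] : exists2 mu, eigenvalue X mu & mu != 0.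
  by apply: normalmx_neq0 => //; apply/hermitian_normalmx/hermsymmxP.
(* Such an [a] gives the eigenvalues [a^-1] of [A] and [1 - a^-1] of [P - A], both nonnegative. *)
have X_ge1 a : eigenvalue X a -> a != 0 -> 0 < a /\ 0 <= 1 - a^-1.
  move=> X_a a0; have [A_a B_a] := eigenvalue_proj_sub AP XP XA X_a a0.
  split; last exact: psdmx_eigenvalue B_a.
  by rewrite lt0r a0 -invr_ge0 (psdmx_eigenvalue A_psd A_a).
have [r [X_r rE r_max]] := spectral_radius_max X_mu.
have r0 : r != 0.
  by rewrite -normr_gt0 (lt_le_trans _ (r_max _ X_mu)) // normr_gt0.
have [r_gt0 r_ge1] := X_ge1 r X_r r0.
have [_ B_r] := eigenvalue_proj_sub AP XP XA X_r r0.
have [b [B_b bE b_max]] := spectral_radius_max B_r.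
have b_ge0 := psdmx_eigenvalue B_psd B_b.
rewrite (gtr0_norm r_gt0) in rE r_max; rewrite (ger0_norm b_ge0) in bE b_max.
have b_eq : b = 1 - r^-1.
  (* The bound [1 - r^-1 <= b] is the maximality of [b]. Conversely, if [b] is nonzero, [(1 - b)^-1]
     is an eigenvalue of [X], hence at most [r]; if [b = 0], use [r_ge1]. *)
  apply/le_anti/andP; split; last by rewrite (le_trans _ (b_max _ B_r)) ?ger0_norm.
  have [->//|b0] := eqVneq b 0.
  have [b1 X_b] := eigenvalue_sub_proj PP AP AX B_b b0.
  have [b1_gt0 _] := X_ge1 _ X_b (invr_neq0 b1).
  have := r_max _ X_b; rewrite gtr0_norm //; rewrite invr_gt0 in b1_gt0.
  by rewrite -lef_pV2 ?posrE ?invr_gt0 // invrK lerBrDl addrC -lerBrDl.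
split; last by rewrite -ltcR bE b_eq gtrBl invr_gt0.
apply: complexI; rewrite bE b_eq fmorph_div rmorphB rmorph1 /= rE.
by rewrite mulrBl divff // mul1r.
Qed.

(** The eigenvalues of [B] are at most 1, so [1%:M - B] is positive semidefinite; compressing it by
    [P] yields [P *m (1%:M - B) *m P = P - B]. *)
Lemma psdmx_proj_sub (R : realType) (n : nat) (P B : 'M[R[i]]_n) :
  P^t* = P -> P *m P = P -> B *m P = B -> psdmx B ->
  spectral_radius B <= 1 -> psdmx (P - B).
Proof.
move=> Ps PP BP B_psd B_le1.
have B_herm := psdmx_herm B_psd.
have PB : P *m B = B.
  by rewrite -(hermsymmxP _ B_herm) -Ps -adjmxM BP.
have B1_psd : psdmx (1%:M - B).
  apply: psdmx_1sub => // a B_a; have [b [_ bE b_max]] := spectral_radius_max B_a.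
  rewrite -(ger0_norm (psdmx_eigenvalue B_psd B_a)) (le_trans (b_max _ B_a)) //.
  by rewrite -bE -(rmorph1 (real_complex R)) lecR.
move=> x; have := B1_psd (P *m x).
suff -> : (P *m x)^t* *m ((1%:M - B) *m (P *m x)) = x^t* *m ((P - B) *m x) by [].
rewrite adjmxM Ps -!mulmxA; congr (_ *m _).
by rewrite !mulmxBl mul1mx mulmxBr !mulmxA PP PB BP.
Qed.

(** * Projections attached to the Moore-Penrose inverse *)

Lemma mulmx_mpinv_range (R : realType) (m n p : nat) (A : 'M[R[i]]_(m, n))
    (B : 'M[R[i]]_(m, p)) :
  (mxrange B `<=` mxrange A)%classic -> A *m mpinv A *m B = B.
Proof.
move=> sBA; have [AXA _ _ _] := mpinvP A.
apply/trmx_inj/row_matrixP => k; rewrite -!tr_col; congr (_^T).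
have [|y _ yE] := sBA (col k B); first by exists (delta_mx k 0); rewrite // colE.
by rewrite colE -mulmxA -colE -yE mulmxA AXA.
Qed.

(** The columns of [1%:M - mpinv A *m A] lie in the nullspace of [A], hence in that of [B]. *)
Lemma mulmx_mpinv_null (R : realType) (m n p : nat) (A : 'M[R[i]]_(m, n))
    (B : 'M[R[i]]_(p, n)) :
  (mxnull A `<=` mxnull B)%classic -> B *m (mpinv A *m A) = B.
Proof.
move=> sAB; have [AXA _ _ _] := mpinvP A; apply/eqP; rewrite eq_sym -subr_eq0.
apply/eqP/trmx_inj/row_matrixP => k; rewrite -!tr_col; congr (_^T).
rewrite col0 -{1}[B]mulmx1 -mulmxBr colE -mulmxA.
by apply: sAB; rewrite /mxnull /= mulmxA mulmxBr mulmx1 mulmxA AXA subrr mul0mx.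
Qed.

(** Hermitian matrices with [E *m F = E] and [F *m E = F] coincide: take the adjoint of the first
    identity. *)
Lemma mpinv_mul_null (R : realType) (m p n : nat) (A : 'M[R[i]]_(m, n))
    (B : 'M[R[i]]_(p, n)) :
  mxnull A = mxnull B -> mpinv A *m A = mpinv B *m B.
Proof.
move=> AB; have [_ _ _ As] := mpinvP A; have [_ _ _ Bs] := mpinvP B.
have EF : mpinv A *m A *m (mpinv B *m B) = mpinv A *m A.
  by rewrite -mulmxA mulmx_mpinv_null ?AB.
have FE : mpinv B *m B *m (mpinv A *m A) = mpinv B *m B.
  by rewrite -mulmxA mulmx_mpinv_null ?AB.
by rewrite -[LHS]As -EF adjmxM As Bs FE.
Qed.

Lemma orthoproj_adj_range (R : realType) (m n : nat) (A : 'M[R[i]]_(m, n)) :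
  orthoproj (mxrange (A^t*)) = mpinv A *m A.
Proof.
apply: (is_orthoproj_uniq (orthoprojP _)).
have [AXA XAX _ XAs] := mpinvP A; split=> //; first by rewrite mulmxA XAX.
apply/seteqP; split=> _ /= [x _ <-].
  (* Both inclusions take adjoints, of [mpinv A *m A] for this one and of [A *m mpinv A *m A = A]
     for the other. *)
  by exists ((mpinv A)^t* *m x); rewrite // mulmxA -adjmxM XAs.
by exists (A^t* *m x); rewrite // -{1}XAs mulmxA -adjmxM mulmxA AXA.
Qed.

Theorem proposition6p3 (R : realType) (m n : nat) (T U V : 'M[R[i]]_(m, n))
    (hsplit : proper_splitting T U V) :
  (loewner_le 0 (mpinv U *m T) /\
   loewner_le (mpinv U *m T) (orthoproj (mxrange (T^t*))))
  <->
  (psdmx (mpinv U *m V) /\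
   spectral_radius (mpinv U *m V) =
     (spectral_radius (mpinv T *m U) - 1) / spectral_radius (mpinv T *m U) /\
   spectral_radius (mpinv U *m V) < 1).
Proof.
have [TE rangeE nullE] := hsplit; rewrite orthoproj_adj_range.
have UT : mpinv U *m U = mpinv T *m T := mpinv_mul_null nullE.
(* Substituting [V = U - T] turns [mpinv U *m V] into [P - A]. *)
have -> : mpinv U *m V = mpinv T *m T - mpinv U *m T.
  by rewrite -UT -mulmxBr TE subKr.
have [TXT XTX _ Ps] := mpinvP T; have [_ UXU _ _] := mpinvP U.
set A := mpinv U *m T; set X := mpinv T *m U; set P := mpinv T *m T in Ps *.
have UUT : U *m mpinv U *m T = T by apply: mulmx_mpinv_range; rewrite rangeE.
have TTU : T *m mpinv T *m U = U by apply: mulmx_mpinv_range; rewrite rangeE.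
have UP : U *m P = U by apply: mulmx_mpinv_null; rewrite nullE.
have PP : P *m P = P by rewrite /P mulmxA XTX.
have AP : A *m P = A by rewrite /A /P -mulmxA (mulmxA T) TXT.
have PX : P *m X = X by rewrite /P /X mulmxA XTX.
have XP : X *m P = X by rewrite /X -mulmxA UP.
have AX : A *m X = P by rewrite /A /X -mulmxA (mulmxA T) TTU UT.
have XA : X *m A = P by rewrite /A /X -mulmxA (mulmxA U) UUT.
split=> [[[_ _ +] [_ _ B_psd]]|[B_psd [_ B_lt1]]].
  rewrite subr0 => A_psd; split; first exact: B_psd.
  exact: spectral_radius_proj_sub Ps PP AP PX XP AX XA A_psd B_psd.
have BP : (P - A) *m P = P - A by rewrite mulmxBl PP AP.
(* Write [A = P - (P - A)] and use that [P - A] has spectral radius below 1. *)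
have A_psd : psdmx A.
  by rewrite -(subKr P A); apply: psdmx_proj_sub; rewrite // ltW.
have A_herm := psdmx_herm A_psd.
have P_herm : P \is hermsymmx by apply/hermsymmxP.
have herm0 : (0 : 'M[R[i]]_n) \is hermsymmx.
  by apply/hermsymmxP; rewrite trmx0 map_mx0.
split; first by split; [exact: herm0 | exact: A_herm | rewrite subr0].
by split; [exact: A_herm | exact: P_herm | exact: B_psd].
Qed.
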